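(* Let $\mathcal{Y}$ be a separable real Hilbert space, let $d\geq1$, $m\in\mathbb{N}$, and let $\mathcal{X}=[0,1]^d$. Let $B\subset\mathcal{Y}$ have finite upper box-counting dimension $\tau_{\mathrm{box}}$, and let $K_B>0$ be such that $\lVert y\rVert_{\mathcal{Y}}\leq K_B$ for all $y\in B$. Then there exist $\delta_0>0$ and a constant $K$ depending only on $K_B$, $m$, $d$ and $\tau_{\mathrm{box}}$ such that for all $0<\delta<\delta_0$, \[H\left(\delta,\mathcal{G}^m_B,\lVert\cdot\rVert_\infty\right)\leq K\delta^{-d/m}\log\left(\frac{1}{\delta}\right).\]
   Context: For a metric space $(\mathcal{Z},\rho)$ and $\delta>0$, $N(\delta,\mathcal{Z},\rho)$ is the minimal number of closed $\rho$-balls of radius $\delta$ with centres in $\mathcal{Z}$ needed to cover $\mathcal{Z}$, and $H(\delta,\mathcal{Z},\rho)=\log N(\delta,\mathcal{Z},\rho)$. The upper box-counting dimension of $E\subset\mathcal{Y}$ is $\tau_{\mathrm{box}}(E)=\limsup_{\delta\to0}\frac{H(\delta,E,\lVert\cdot\rVert_{\mathcal{Y}})}{-\log\delta}$. For $p\in\mathbb{N}_0^d$ write $[p]=p_1+\dots+p_d$ and $D^pg=\partial_1^{p_1}\cdots\partial_d^{p_d}g$, with $D^0g=g$. $\mathcal{G}^m_B$ is the set of $m$-times differentiable functions $g:\mathcal{X}\to\mathcal{Y}$ whose partial derivatives $D^pg$ of orders $[p]\leq m$ exist everywhere on the interior of $\mathcal{X}$ and satisfy $D^pg(x)\in B$ for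 all $x\in\mathcal{X}$ and all $[p]\leq m$. $\lVert g\rVert_\infty=\sup_{x\in\mathcal{X}}\lVert g(x)\rVert_{\mathcal{Y}}$. *)

(* Defs.v *)
From HB Require Import structures.
From mathcomp Require Import all_boot all_order all_algebra.
From mathcomp Require Import all_classical all_reals all_analysis.
Set Implicit Arguments. Unset Strict Implicit. Unset Printing Implicit Defensive.
Import Order.TTheory GRing.Theory Num.Theory.
Import numFieldNormedType.Exports.
Local Open Scope classical_set_scope.
Local Open Scope ring_scope.

Section Defs.
Context {R : realType}.

Definition is_inner_product (Y : normedModType R) (ip : Y -> Y -> R) : Prop :=
  (forall x y : Y, ip x y = ip y x) /\
  (forall (a : R) (x y z : Y), ip (a *: x + y) z = a * ip x z + ip y z) /\
  (forall x : Y, ip x x = `|x| ^+ 2).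

Definition separable_space (Y : normedModType R) : Prop :=
  exists D : set Y, countable D /\ closure D = setT.

Definition separable_hilbert_space (Y : completeNormedModType R) : Prop :=
  (exists ip : Y -> Y -> R, is_inner_product ip) /\ separable_space Y.

(* rho is a (possibly infinite-valued) distance.
   N(delta, Z, rho): minimal number of closed rho-balls of radius delta
   with centres in Z covering Z (+oo if no finite cover exists). *)
Definition covering_number (T : Type) (rho : T -> T -> \bar R)
    (delta : R) (Z : set T) : \bar R :=
  ereal_inf [set (n%:R)%:E | n in
    [set n : nat | exists c : 'I_n -> T,
       (forall k, Z (c k)) /\
       (forall z, Z z -> exists k, (rho (c k) z <= delta%:E)%E)]].

Definition elog (x : \bar R) : \bar R :=
  match x with
  | r%:E => if r == 0 then -oo%E else (ln r)%:E
  | +oo%E => +oo%E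
  | -oo%E => -oo%E
  end.

Definition metric_entropy (T : Type) (rho : T -> T -> \bar R)
    (delta : R) (Z : set T) : \bar R :=
  elog (covering_number rho delta Z).

Definition norm_dist (Y : normedModType R) (y z : Y) : \bar R :=
  (`|y - z|)%:E.

Definition upper_box_dim (Y : normedModType R) (E : set Y) : \bar R :=
  ereal_inf [set ereal_sup
      [set (metric_entropy (@norm_dist Y) delta E * ((- ln delta)^-1)%:E)%E
        | delta in `]0, eps[%classic]
    | eps in `]0, 1[%classic].

Definition cube (d : nat) : set 'rV[R]_d :=
  [set x | forall j : 'I_d, 0 <= x ord0 j <= 1].

Definition unit_vec (d : nat) (i : 'I_d) : 'rV[R]_d := delta_mx ord0 i.

Definition diff_quot (Y : normedModType R) (d : nat) (i : 'I_d)
    (f : 'rV[R]_d -> Y) (x : 'rV[R]_d) : R -> Y :=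
  fun h => h^-1 *: (f (x + h *: unit_vec i) - f x).

Definition adm_incr (d : nat) (i : 'I_d) (x : 'rV[R]_d) : set R :=
  [set h | @cube d (x + h *: unit_vec i)].

(* partial derivative d/dx_i, taken within the cube (so one-sided on the
   boundary, the usual two-sided one in the interior) *)
Definition partial (Y : normedModType R) (d : nat) (i : 'I_d)
    (f : 'rV[R]_d -> Y) : 'rV[R]_d -> Y :=
  fun x => lim (diff_quot i f x @ within (adm_incr i x) (0 : R)^').

Definition partial_exists (Y : normedModType R) (d : nat) (i : 'I_d)
    (f : 'rV[R]_d -> Y) (x : 'rV[R]_d) : Prop :=
  cvg (diff_quot i f x @ within (adm_incr i x) (0 : R)^').

Definition order_mi (d : nat) (p : 'I_d -> nat) : nat := (\sum_(i < d) p i)%N.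

Definition mi_dirs (d : nat) (p : 'I_d -> nat) : seq 'I_d :=
  flatten [seq nseq (p i) i | i <- enum 'I_d].

Definition iter_partial (Y : normedModType R) (d : nat) (s : seq 'I_d)
    (f : 'rV[R]_d -> Y) : 'rV[R]_d -> Y :=
  foldr (fun i g => partial i g) f s.

Definition Dmi (Y : normedModType R) (d : nat) (p : 'I_d -> nat)
    (g : 'rV[R]_d -> Y) : 'rV[R]_d -> Y :=
  iter_partial (mi_dirs p) g.

(* every partial derivative taken in the computation of D^p g exists at x *)
Definition Dmi_exists (Y : normedModType R) (d : nat) (p : 'I_d -> nat)
    (g : 'rV[R]_d -> Y) (x : 'rV[R]_d) : Prop :=
  forall (k : nat) (i : 'I_d) (s : seq 'I_d),
    drop k (mi_dirs p) = i :: s -> partial_exists i (iter_partial s g) x.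

Definition Gclass (Y : normedModType R) (d m : nat) (B : set Y) :
    set ('rV[R]_d -> Y) :=
  [set g | forall p : 'I_d -> nat, (order_mi p <= m)%N ->
     forall x, @cube d x -> Dmi_exists p g x /\ B (Dmi p g x)].

Definition sup_dist (Y : normedModType R) (d : nat)
    (g h : 'rV[R]_d -> Y) : \bar R :=
  ereal_sup [set (`|g x - h x|)%:E | x in @cube d].

End Defs.
Arguments cube {R} d.

(* Main.v *)
Require Import Defs.
From HB Require Import structures.
From mathcomp Require Import all_boot all_order all_algebra.
From mathcomp Require Import all_classical all_reals all_analysis.
From mathcomp Require Import ring lra.
Import Order.TTheory GRing.Theory Num.Theory.
Import numFieldNormedType.Exports.
Local Open Scope classical_set_scope.
Local Open Scope ring_scope.

(** Put the grid of mesh [e = 1/N] with [N ~ delta^(-1/m)] on the cube, and record,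
    for every grid point [z] and every multi-index [p] of order at most [m], an
    element of a finite [e^m/2]-net of [B] close to [D^p g z].  Two functions with
    the same record are within [(m+1)^d (1 + 2 KB) e^m <= delta] of each other:
    travelling from [z] to [x] one coordinate at a time, the mean value inequality
    propagates bounds of the form [|D^p g - D^p h| <= C e^(m - |p|)] downwards in
    the order of [p], starting from the trivial bound [2 KB] at order [m].  There
    are at most [(N+1)^d (m+1)^d] entries in a record, and the box dimension makes
    the logarithm of the size of the net [O(log(1/delta))].

    The derivatives [D^p] are computed in a fixed order of the variables, the first
    variable outermost; the path changes the coordinates in increasing order so
    that no exchange of partial derivatives is needed. *)

(** * Mean value inequality on a segment *)

(** Supremum argument, since [u] is vector-valued: with slope [M + e], the set of times satisfying
    the bound contains its supremum [c], and [c < b] would give a later time in the set. The local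
    hypothesis only tests points of [[a, b]], which suits derivatives that are one-sided on the
    boundary of the cube. *)
Lemma mean_value_ineq (R : realType) (Y : normedModType R) (u : R -> Y)
    (a b M : R) :
  a <= b ->
  (forall t, a <= t <= b -> forall e, 0 < e ->
     exists2 eta, 0 < eta &
       forall s, a <= s <= b -> `|s - t| < eta ->
         `|u s - u t| <= (M + e) * `|s - t|) ->
  `|u b - u a| <= M * (b - a).
Proof.
move=> ab lip; apply/ler_addgt0Pr => e0 e0_gt0.
(* The [+ 1] keeps the denominator positive when [a = b]. *)
pose e := e0 / (b - a + 1).
have ba1 : 0 < b - a + 1 by lra.
have e_gt0 : 0 < e by rewrite divr_gt0.
have e_le : e * (b - a) <= e0.
  rewrite /e mulrAC ler_pdivrMr // ler_pM2l //; lra.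
suff: `|u b - u a| <= (M + e) * (b - a).
  by move=> /le_trans; apply; rewrite mulrDl lerD2l.
pose S := [set t | a <= t <= b /\ `|u t - u a| <= (M + e) * (t - a)].
have Sa : S a by split; [lra|rewrite !subrr normr0 mulr0].
have supS : has_sup S by split; [exists a|exists b => t [/andP[]]].
set c := sup S.
have ac : a <= c by apply: ub_le_sup Sa; case: supS.
have cb : c <= b by apply: ge_sup; [exists a|move=> t [/andP[]]].
have cab : a <= c <= b by rewrite ac.
have [eta eta_gt0 Hc] := lip c cab e e_gt0.
have Sc : `|u c - u a| <= (M + e) * (c - a).
  have [t [tab St] tc] := sup_adherent eta_gt0 supS.
  have tlec : t <= c by apply: ub_le_sup; [case: supS|split].
  have := Hc t tab; rewrite distrC (distrC (u t)) ger0_norm; last lra.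
  move=> /(_ ltac:(rewrite /c in tlec *; lra)) h.
  rewrite -(subrK (u t) (u c)) -addrA.
  apply: (le_trans (ler_normD _ _)); apply: (le_trans (lerD h St)).
  by rewrite -mulrDr le_eqVlt; apply/orP; left; apply/eqP; congr (_ * _); ring.
case: (ltP c b) => [ltcb|bc]; last by have -> : b = c by lra.
pose s := Num.min (c + eta / 2) b.
have cs : c < s by rewrite /s lt_min ltcb andbT; lra.
have sb : s <= b by rewrite /s ge_min lexx orbT.
have seta : s <= c + eta / 2 by rewrite /s ge_min lexx.
have : S s.
  split; first lra.
  have := Hc s; rewrite ger0_norm; last lra.
  move=> /(_ ltac:(lra) ltac:(lra)) h.
  rewrite -(subrK (u c) (u s)) -addrA.
  apply: (le_trans (ler_normD _ _)); apply: (le_trans (lerD h Sc)).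
  by rewrite -mulrDr le_eqVlt; apply/orP; left; apply/eqP; congr (_ * _); ring.
by move=> /(ub_le_sup (proj2 supS)); rewrite -/c; lra.
Qed.

(** * First-order expansion of the derivatives *)

Lemma partial_approx (R : realType) (Y : normedModType R) (d : nat) (i : 'I_d)
    (f : 'rV[R]_d -> Y) (x : 'rV[R]_d) (e : R) :
  partial_exists i f x -> 0 < e ->
  exists2 eta, 0 < eta &
    forall h, `|h| < eta -> cube d (x + h *: unit_vec i) ->
      `|f (x + h *: unit_vec i) - f x - h *: partial i f x| <= e * `|h|.
Proof.
move=> ex e_gt0.
have /cvgrPdist_le /(_ e e_gt0) : diff_quot i f x @ within (adm_incr i x) (0 : R)^'
    --> partial i f x by exact: ex.
rewrite !near_withinE => -[/= eta eta_gt0 Heta].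
exists eta => // h h_eta hcube.
have [->|h0] := eqVneq h 0.
  by rewrite !scale0r addr0 subrr subr0 !normr0 mulr0.
have := Heta h; rewrite /= sub0r normrN => /(_ h_eta h0 hcube).
rewrite /diff_quot => le_e.
have -> : f (x + h *: unit_vec i) - f x - h *: partial i f x =
    - (h *: (partial i f x - h^-1 *: (f (x + h *: unit_vec i) - f x))).
  by rewrite scalerBr scalerA divff // scale1r opprB.
by rewrite normrN normrZ mulrC ler_wpM2r.
Qed.

Definition mi_incr {d : nat} (j : 'I_d) (p : 'I_d -> nat) : 'I_d -> nat :=
  fun i => (p i + (i == j))%N.

Lemma order_mi_incr (d : nat) (j : 'I_d) (p : 'I_d -> nat) :
  order_mi (mi_incr j p) = (order_mi p).+1.
Proof.
rewrite /order_mi /mi_incr big_split /= -addn1; congr (_ + _)%N.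
by rewrite (bigD1 j) //= eqxx big1 // => i /negbTE ->.
Qed.

(** The directions are listed in increasing order, outermost derivative first. As [p] vanishes
    before [j], nothing precedes the added [j], which therefore lands at the head. *)
Lemma mi_dirs_incr (d : nat) (j : 'I_d) (p : 'I_d -> nat) :
  (forall i : 'I_d, (i < j)%N -> p i = 0%N) ->
  mi_dirs (mi_incr j p) = j :: mi_dirs p.
Proof.
move=> p0; rewrite /mi_dirs.
have : pairwise ltn (map val (enum 'I_d)).
  by rewrite val_enum_ord -(sorted_pairwise ltn_trans) iota_ltn_sorted.
have : j \in enum 'I_d by rewrite mem_enum.
case/splitPr => s1 s2.
rewrite map_cat pairwise_cat /= => /and3P[/allrelP lt1 _ /andP[/allP lt2 _]].
have nil1 q : (forall i : 'I_d, (i < j)%N -> q i = 0%N) ->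
    flatten [seq nseq (q i) i | i <- s1] = [::].
  move=> q0; elim: s1 lt1 => //= i s1 IH lt1.
  rewrite q0 /=; last by apply: lt1; rewrite !inE eqxx.
  by apply: IH => a b sa sb; apply: lt1 => //; rewrite inE sa orbT.
rewrite !map_cat !flatten_cat /= !nil1 //=; last first.
  move=> i ij; rewrite /mi_incr p0 //.
  by case: eqP => // ij'; rewrite ij' ltnn in ij.
rewrite {1}/mi_incr eqxx addn1 /=; congr (_ :: _ ++ flatten _).
apply/eq_in_map => i is2; rewrite /mi_incr.
have := lt2 (val i); rewrite map_f // => /(_ isT) /= ji.
by case: eqP => [ij|]; rewrite ?addn0 //; rewrite ij ltnn in ji.
Qed.

Lemma Dmi_incr_approx (R : realType) (Y : normedModType R) (d m : nat)
    (B : set Y) (g : 'rV[R]_d -> Y) (j : 'I_d) (p : 'I_d -> nat) (x : 'rV[R]_d)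
    (e : R) :
  Gclass m B g -> (order_mi p < m)%N ->
  (forall i : 'I_d, (i < j)%N -> p i = 0%N) -> cube d x -> 0 < e ->
  exists2 eta, 0 < eta &
    forall h, `|h| < eta -> cube d (x + h *: unit_vec j) ->
      `|Dmi p g (x + h *: unit_vec j) - Dmi p g x
          - h *: Dmi (mi_incr j p) g x| <= e * `|h|.
Proof.
move=> Gg pm p0 xcube e_gt0.
have [] := Gg (mi_incr j p) _ x xcube; first by rewrite order_mi_incr.
move=> Dex _; rewrite /Dmi mi_dirs_incr //=.
apply: partial_approx => //.
(* Position 0 of the direction list is the outermost derivative. *)
by apply: (Dex 0%N); rewrite drop0 mi_dirs_incr.
Qed.

(** * Propagation of bounds away from a grid point *)

Lemma Dmi_sub_le (R : realType) (Y : normedModType R) (d m : nat)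
    (B : set Y) (g h : 'rV[R]_d -> Y) (j : 'I_d) (p : 'I_d -> nat)
    (w : 'rV[R]_d) (t M : R) :
  Gclass m B g -> Gclass m B h -> (order_mi p < m)%N ->
  (forall i : 'I_d, (i < j)%N -> p i = 0%N) ->
  0 <= t -> cube d w -> cube d (w + t *: unit_vec j) ->
  (forall s, 0 <= s <= t ->
     `|Dmi (mi_incr j p) g (w + s *: unit_vec j)
       - Dmi (mi_incr j p) h (w + s *: unit_vec j)| <= M) ->
  `|(Dmi p g (w + t *: unit_vec j) - Dmi p h (w + t *: unit_vec j))
    - (Dmi p g w - Dmi p h w)| <= M * t.
Proof.
move=> Gg Gh pm p0 t0 wcube wtcube leM.
pose u s := Dmi p g (w + s *: unit_vec j) - Dmi p h (w + s *: unit_vec j).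
have cube_s s : 0 <= s <= t -> cube d (w + s *: unit_vec j).
  move=> /andP[s0 st] i; have := wcube i; have := wtcube i; rewrite !mxE eqxx /=.
  by case: eqP => _; rewrite ?mulr1 ?mulr0; lra.
have -> : Dmi p g w - Dmi p h w = u 0 by rewrite /u scale0r addr0.
rewrite -[t in M * t]subr0; apply: (mean_value_ineq _ _ u) => // s st e e_gt0.
have e2_gt0 : 0 < e / 2 by lra.
have [eg eg_gt0 Hg] :=
  Dmi_incr_approx _ _ _ _ _ _ _ _ _ _ Gg pm p0 (cube_s s st) e2_gt0.
have [eh eh_gt0 Hh] :=
  Dmi_incr_approx _ _ _ _ _ _ _ _ _ _ Gh pm p0 (cube_s s st) e2_gt0.
exists (Num.min eg eh); first by rewrite lt_min eg_gt0.
move=> r rt; rewrite lt_min => /andP[rg rh].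
have rE : w + s *: unit_vec j + (r - s) *: unit_vec j = w + r *: unit_vec j.
  by rewrite -addrA -scalerDl (addrC s) subrK.
have := Hh _ rh; have := Hg _ rg; rewrite rE /u.
move=> /(_ (cube_s _ rt)) leg /(_ (cube_s _ rt)) leh.
have := leM _ st.
move: leg leh.
set g1 := Dmi p g _; set g0 := Dmi p g _; set g' := Dmi _ g _.
set h1 := Dmi p h _; set h0 := Dmi p h _; set h' := Dmi _ h _.
move=> leg leh leM'.
(* The linear part is at most [M * |r - s|], and each of the two remainders at most
   [e / 2 * |r - s|]. *)
have -> : g1 - h1 - (g0 - h0) = (r - s) *: (g' - h') +
    ((g1 - g0 - (r - s) *: g') - (h1 - h0 - (r - s) *: h')).
  have subrACA (x y a b : Y) : x - y - (a - b) = x - a - (y - b).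
    by rewrite !opprD addrACA.
  by rewrite (subrACA (g1 - g0)) (subrACA g1 g0) -scalerBr [RHS]addrC subrK.
apply: (le_trans (ler_normD _ _)); rewrite mulrDl.
apply: lerD; first by rewrite normrZ mulrC ler_wpM2r.
apply: (le_trans (ler_normB _ _)); apply: (le_trans (lerD leg leh)).
by rewrite -mulrDl; apply: ler_wpM2r => //; lra.
Qed.

(** Induction on the number [j] of coordinates that have moved away from [z]. One more coordinate
    costs a factor at most [m.+1]: if [C * e ^+ k] bounds the order [m - k] before the move, then
    [k.+1%:R * C * e ^+ k] bounds it after, because each drop in order multiplies the previous bound
    by a length at most [e] and adds the value at the start of the segment. *)
Lemma Dmi_sub_le_box (R : realType) (Y : normedModType R) (d m : nat)
    (B : set Y) (g h : 'rV[R]_d -> Y) (z : 'rV[R]_d) (e L : R) :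
  Gclass m B g -> Gclass m B h -> cube d z -> 0 <= e -> 0 <= L ->
  (forall p x, cube d x -> order_mi p = m -> `|Dmi p g x - Dmi p h x| <= L) ->
  (forall p, (order_mi p <= m)%N ->
     `|Dmi p g z - Dmi p h z| <= L * e ^+ (m - order_mi p)) ->
  forall (j : nat), (j <= d)%N -> forall (w : 'rV[R]_d) (p : 'I_d -> nat),
    cube d w ->
    (forall i, z ord0 i <= w ord0 i <= z ord0 i + e) ->
    (forall i : 'I_d, (j <= i)%N -> w ord0 i = z ord0 i) ->
    (forall i : 'I_d, (i < j)%N -> p i = 0%N) -> (order_mi p <= m)%N ->
    `|Dmi p g w - Dmi p h w| <= m.+1%:R ^+ j * L * e ^+ (m - order_mi p).
Proof.
move=> Gg Gh zcube e0 L0 top base; elim=> [_|j IHj jd] w p wcube zw wz p0 pm.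
  have -> : w = z by apply/rowP => i; rewrite wz.
  by rewrite expr0 mul1r base.
pose jo := Ordinal jd.
set C := m.+1%:R ^+ j * L in IHj.
have C0 : 0 <= C by rewrite mulr_ge0 // exprn_ge0.
(* Inside the induction on [m - order_mi p] the [j]-th entry of [p] is free, since
   each use of the mean value inequality in direction [j] increments it. *)
suff claim k : forall (w : 'rV[R]_d) (p : 'I_d -> nat), cube d w ->
    (forall i, z ord0 i <= w ord0 i <= z ord0 i + e) ->
    (forall i : 'I_d, (j < i)%N -> w ord0 i = z ord0 i) ->
    (forall i : 'I_d, (i < j)%N -> p i = 0%N) -> (order_mi p + k)%N = m ->
    `|Dmi p g w - Dmi p h w| <= k.+1%:R * C * e ^+ k.
  have := claim (m - order_mi p)%N w p wcube zw wz _ (subnKC pm).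
  move=> /(_ (fun i ij => p0 i (ltnW ij))) /le_trans; apply.
  rewrite ler_wpM2r ?exprn_ge0 // exprS -mulrA ler_wpM2r // ler_nat ltnS.
  exact: leq_subr.
elim: k {w p wcube zw wz p0 pm} => [|k IHk] w p wcube zw wz p0 pm.
  rewrite expr0 mulr1 mul1r (le_trans (top _ _ wcube _)) -?[in RHS]pm ?addn0 //.
  by rewrite ler_peMl // exprn_ege1 // ler1n.
pose t := w ord0 jo - z ord0 jo.
have /andP[t0 te] : 0 <= t <= e by have := zw jo; rewrite /t; lra.
(* Resetting coordinate [j] of [w] to that of [z] gives the start of the segment, where [IHj]
   applies. *)
pose w' := w - t *: unit_vec jo.
have w'E s i : (w' + s *: unit_vec jo) ord0 i =
    if i == jo then z ord0 jo + s else w ord0 i.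
  rewrite !mxE eqxx /=; case: eqP => [->|_]; rewrite ?mulr1 ?mulr0 /t; ring.
have w'tE : w' + t *: unit_vec jo = w by rewrite /w' subrK.
have w'0E : w' = w' + 0 *: unit_vec jo by rewrite scale0r addr0.
have cubes s : 0 <= s <= t -> cube d (w' + s *: unit_vec jo).
  move=> st i; rewrite w'E; case: eqP => // _.
  by have := wcube jo; have := zcube jo; move: st; rewrite /t; lra.
have boxs s : 0 <= s <= t -> forall i,
    z ord0 i <= (w' + s *: unit_vec jo) ord0 i <= z ord0 i + e.
  move=> /andP[s0 st] i; rewrite w'E; case: eqP => [->|_]; last exact: zw.
  by rewrite lerDl s0 lerD2l (le_trans st te).
have t00 : (0 : R) <= 0 <= t by rewrite lexx.
have pk : (order_mi p <= m)%N by rewrite -pm leq_addr.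
have h0 : `|Dmi p g w' - Dmi p h w'| <= C * e ^+ k.+1.
  have -> : k.+1 = (m - order_mi p)%N by rewrite -pm addKn.
  apply: IHj => //; first exact: ltnW.
  - by rewrite w'0E; exact: cubes.
  - by rewrite w'0E; exact: boxs.
  - move=> i; rewrite w'0E w'E; case: eqP => [->|neq ji]; first by rewrite addr0.
    by apply: wz; rewrite ltn_neqAle ji andbT; apply/eqP => ij; apply/neq/val_inj.
have := Dmi_sub_le _ _ _ _ _ g h jo p w' t (k.+1%:R * C * e ^+ k) Gg Gh.
rewrite w'tE => main.
have {}main : `|Dmi p g w - Dmi p h w - (Dmi p g w' - Dmi p h w')|
    <= k.+1%:R * C * e ^+ k * t.
  apply: main => [|||||s st] //.
  - by rewrite -pm -addn1 leq_add2l.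
  - by rewrite w'0E; exact: cubes.
  apply: IHk; [exact: cubes|exact: boxs| | |].
  - move=> i ji; rewrite w'E; case: eqP => [ij|_]; last exact: wz.
    by rewrite ij /= ltnn in ji.
  - move=> i ij; rewrite /mi_incr p0 //; case: eqP => // ij'.
    by rewrite ij' /= ltnn in ij.
  - by rewrite order_mi_incr addSnnS.
rewrite -(subrK (Dmi p g w' - Dmi p h w') (Dmi p g w - Dmi p h w)).
apply: (le_trans (ler_normD _ _)); apply: (le_trans (lerD main h0)).
have -> : k.+2%:R * C * e ^+ k.+1 = k.+1%:R * C * e ^+ k * e + C * e ^+ k.+1.
  by rewrite -[k.+2]addn1 natrD exprS; ring.
by rewrite lerD2r; apply: ler_wpM2l => //; rewrite !mulr_ge0 ?exprn_ge0.
Qed.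

Lemma sup_dist_le (R : realType) (Y : normedModType R) (d m : nat)
    (B : set Y) (KB e : R) (Z : set 'rV[R]_d) (g h : 'rV[R]_d -> Y) :
  (forall y, B y -> `|y| <= KB) -> 0 < KB -> 0 < e <= 1 ->
  Gclass m B g -> Gclass m B h ->
  Z `<=` cube d ->
  (forall x, cube d x ->
     exists2 z, Z z & forall i, z ord0 i <= x ord0 i <= z ord0 i + e) ->
  (forall z p, Z z -> (order_mi p <= m)%N ->
     `|Dmi p g z - Dmi p h z| <= e ^+ m) ->
  (sup_dist g h <= (m.+1%:R ^+ d * (1 + 2 * KB) * e ^+ m)%:E)%E.
Proof.
move=> BK KB0 /andP[e0 e1] Gg Gh Zcube Zdense base.
apply: ge_ereal_sup => _ [x xcube <-]; rewrite lee_fin.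
have [z Zz zx] := Zdense x xcube.
have Dmi0 f : Dmi (fun=> 0%N) f = f :> ('rV[R]_d -> Y).
  rewrite /Dmi; have -> // : mi_dirs (fun _ : 'I_d => 0%N) = [::].
  by rewrite /mi_dirs; elim: (enum _).
have order0 : order_mi (fun _ : 'I_d => 0%N) = 0%N by rewrite /order_mi big1.
(* In [L = 1 + 2 * KB], the part [2 * KB] covers the top order, and [1 <= L] suffices at [z] because
   [e ^+ m <= e ^+ (m - order_mi p)]. *)
have := Dmi_sub_le_box _ _ _ _ _ g h z e (1 + 2 * KB) Gg Gh (Zcube z Zz)
  (ltW e0) _ _ _ d (leqnn d) x (fun=> 0%N) xcube zx.
rewrite !Dmi0 order0 subn0; apply => //.
- by lra.
- move=> p y ycube pm; apply: (le_trans (ler_normB _ _)).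
  have [_ /BK] := Gg p (eq_leq pm) y ycube.
  have [_ /BK] := Gh p (eq_leq pm) y ycube.
  lra.
- move=> p pm; apply: (le_trans (base _ _ Zz pm)).
  apply: (@le_trans _ _ (e ^+ (m - order_mi p))).
    by apply: ler_wiXn2l => //; [exact: ltW|exact: leq_subr].
  by rewrite ler_peMl ?exprn_ge0 ?ltW //; lra.
- by move=> i; rewrite leqNgt ltn_ord.
Qed.

(** * Covering numbers, entropy and box dimension *)

Lemma elog_le (R : realType) (x : \bar R) (c : R) :
  (0 <= x)%E -> (x <= (expR c)%:E)%E -> (elog x <= c%:E)%E.
Proof.
case: x => [r| |] //; rewrite !lee_fin => r0 rc /=.
case: eqVneq => [_|rn0]; first by rewrite leNye.
by rewrite lee_fin -[c]expRK ler_ln ?posrE ?expR_gt0 // lt_neqAle eq_sym rn0.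
Qed.

Lemma covering_number_ge0 (R : realType) (T : Type) (rho : T -> T -> \bar R)
    (delta : R) (Z : set T) :
  (0 <= covering_number rho delta Z)%E.
Proof. by apply: le_ereal_inf_tmp => _ [n _ <-]; rewrite lee_fin. Qed.

(** Centres have to lie in [Z], so each code that occurs is represented by some point of [Z]
    carrying it, and the ball around that point contains every other carrier. *)
Lemma covering_number_le (R : realType) (T : Type) (rho : T -> T -> \bar R)
    (delta : R) (Z : set T) (I : finType) (code : T -> I -> Prop) :
  (forall z, Z z -> exists i, code z i) ->
  (forall z z' i, Z z -> Z z' -> code z i -> code z' i ->
     (rho z z' <= delta%:E)%E) ->
  (covering_number rho delta Z <= (#|I|%:R)%:E)%E.
Proof.
move=> coded close.
pose A := [pred i : I | `[< exists2 z, Z z & code z i >]].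
apply: ge_ereal_inf; exists (#|A|%:R)%:E; last by rewrite lee_fin ler_nat max_card.
exists #|A| => //.
have rep (k : 'I_#|A|) : exists z, Z z /\ code z (enum_val k).
  by have /asboolP[z Zz cz] := enum_valP k; exists z.
have [c /all_and2[Zc codec]] := choice rep.
exists c; split => // z Zz; have [i zi] := coded z Zz.
have Ai : i \in A by apply/asboolP; exists z.
exists (enum_rank_in Ai i); apply: close (zi) => //.
by rewrite -[X in code _ X](enum_rankK_in Ai).
Qed.

(* One unit above [tau] is the slack in the limsup, the other one absorbs the
   rounding of the covering number to an integer. *)
Lemma upper_box_dim_cover (R : realType) (Y : normedModType R) (B : set Y)
    (tau : R) :
  upper_box_dim B = tau%:E ->
  exists2 eps, 0 < eps & forall r, 0 < r < eps -> r <= 2^-1 ->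
    exists n (c : 'I_n -> Y),
      n%:R <= expR ((`|tau| + 2) * ln r^-1) /\
      forall y, B y -> exists k, `|c k - y| <= r.
Proof.
move=> dimB.
have : (upper_box_dim B < (`|tau| + 1)%:E)%E.
  by rewrite dimB lte_fin; have := ler_norm tau; lra.
move=> /ereal_inf_lt[_ [eps /= + <-]]; rewrite in_itv /= => /andP[eps0 eps1].
move=> supB; exists eps => // r /andP[r0 reps] r2.
have lnr : 0 < - ln r by rewrite -lnV ?posrE // ln_gt0 // invf_gt1 //; lra.
have lnr2 : ln 2 <= - ln r.
  by rewrite -lnV ?posrE // ler_ln ?posrE ?invr_gt0 // -[leLHS]invrK lef_pV2 ?posrE.
have : (metric_entropy (@norm_dist R Y) r B * ((- ln r)^-1)%:E
    < (`|tau| + 1)%:E)%E.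
  apply: le_lt_trans supB; apply: ereal_sup_ubound; exists r => //=.
  by rewrite in_itv /= r0.
rewrite lnV ?posrE //; set l := - ln r in lnr lnr2 *.
(* The right disjunct contradicts the entropy bound just obtained; it disposes of an infinite
   covering number. An empty [B] has covering number 0 and satisfies the left one. *)
have : (covering_number (@norm_dist R Y) r B < (expR ((`|tau| + 1) * l) + 1)%:E)%E
    \/ ~ (metric_entropy (@norm_dist R Y) r B * (l^-1)%:E
    < (`|tau| + 1)%:E)%E.
  rewrite /metric_entropy; have := covering_number_ge0 R _ (@norm_dist R Y) r B.
  case: covering_number => [N| |] // N0.
    rewrite /elog; case: eqVneq N0 => [-> _|N0 N_ge0].
      by left; rewrite lte_fin; have := expR_gt0 ((`|tau| + 1) * l); lra.
    have [le|/negP nlt] := boolP ((ln N)%:E * (l^-1)%:E < (`|tau| + 1)%:E)%E;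
      last by right.
    left; move: le; rewrite -EFinM lte_fin ltr_pdivrMr // => le.
    apply: (@le_lt_trans _ _ (expR ((`|tau| + 1) * l))); last lra.
    rewrite -[N]lnK ?ler_expR ?ltW // posrE lt_neqAle eq_sym N0.
    by rewrite -lee_fin.
  by right => /=; rewrite mulyr gtr0_sg ?invr_gt0 // mul1e.
case=> // /ereal_inf_lt[_ [n [c [_ cover]] <-]]; rewrite lte_fin => ltn _.
exists n, c; split; last first.
  by move=> y /cover[k]; rewrite lee_fin; exists k.
apply: (le_trans (ltW ltn)).
(* [E >= 1], and [expR l >= 2] because [r <= 2^-1], so [E + 1 <= 2 * E <= E * expR l]. *)
set E := expR _.
have E1 : 1 <= E.
  by rewrite -expR0 ler_expR mulr_ge0 ?ltW //; have := normr_ge0 tau; lra.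
have -> : expR ((`|tau| + 2) * l) = E * expR l.
  by rewrite -expRD; congr expR; ring.
have : 2 <= expR l by rewrite -[leLHS](@lnK R 2) ?posrE // ler_expR.
nra.
Qed.

(** * Counting the records on a grid *)

Lemma covering_number_Gclass_le (R : realType) (Y : normedModType R)
    (d m N n : nat) (B : set Y) (KB delta : R) (c : 'I_n -> Y) :
  (forall y, B y -> `|y| <= KB) -> 0 < KB -> (0 < N)%N ->
  (forall y, B y -> exists k, `|c k - y| <= N%:R ^- m / 2) ->
  m.+1%:R ^+ d * (1 + 2 * KB) * N%:R ^- m <= delta ->
  (covering_number (@sup_dist R Y d) delta (@Gclass R Y d m B)
     <= ((n ^ (N.+1 ^ d * m.+1 ^ d))%N%:R)%:E)%E.
Proof.
move=> BK KB0 N0 cover le_delta.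
have N0R : (0 : R) < N%:R by rewrite ltr0n.
pose I := ({ffun 'I_d -> 'I_N.+1} * {ffun 'I_d -> 'I_m.+1})%type.
pose grid (k : {ffun 'I_d -> 'I_N.+1}) : 'rV[R]_d :=
  \row_i ((k i : nat)%:R / N%:R).
have grid_cube k : cube d (grid k).
  move=> i; rewrite mxE divr_ge0 ?ler0n //= ler_pdivrMr // mul1r ler_nat.
  by rewrite -ltnS.
(* Entries of [q.2] up to [m] suffice for all orders at most [m]; where the order exceeds [m], the
   record is unconstrained. *)
pose code g (phi : {ffun I -> 'I_n}) := forall q : I,
  (order_mi (fun i => q.2 i : nat) <= m)%N ->
  `|c (phi q) - Dmi (fun i => q.2 i : nat) g (grid q.1)| <= N%:R ^- m / 2.
have -> : (n ^ (N.+1 ^ d * m.+1 ^ d))%N = #|{ffun I -> 'I_n}|.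
  by rewrite card_ffun card_prod !card_ffun !card_ord.
apply: (covering_number_le _ _ _ _ _ _ code) => [g Gg|g h phi Gg Gh gphi hphi].
  (* The value of [g] at the origin lies in [B], so there is at least one centre; [i0] fills the
     unconstrained entries. *)
  have [i0 _] : exists i : 'I_n, true.
    have [|_ /cover[i _]] := Gg (fun=> 0%N) _ _ (grid_cube [ffun=> ord0]).
      by rewrite /order_mi big1.
    by exists i.
  have ex (q : I) : exists i, (order_mi (fun i => q.2 i : nat) <= m)%N ->
      `|c i - Dmi (fun i => q.2 i : nat) g (grid q.1)| <= N%:R ^- m / 2.
    case: leqP => qm; last by exists i0.
    by have [_ /cover[i]] := Gg _ qm _ (grid_cube q.1); exists i.
  have [phi Hphi] := choice ex.
  by exists [ffun q => phi q] => q qm; rewrite ffunE; exact: Hphi.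
apply: (@le_trans _ _ (m.+1%:R ^+ d * (1 + 2 * KB) * N%:R^-1 ^+ m)%:E); last first.
  by rewrite lee_fin exprVn.
apply: (sup_dist_le _ _ _ _ B _ _ (range grid)) => //.
- by rewrite invr_gt0 N0R invf_le1 // ler1n.
- by move=> _ [k _ <-].
- move=> x xcube.
  (* Round each coordinate of [x] down to a multiple of [1 / N]. *)
  exists (grid [ffun i => inord (Num.truncn (x ord0 i * N%:R))]); first by eexists.
  move=> i; have /andP[x0 x1] := xcube i.
  have xN : 0 <= x ord0 i * N%:R by rewrite mulr_ge0 // ltW.
  rewrite mxE ffunE inordK; last first.
    by rewrite ltnS truncn_le_nat -natr1 ltr_pwDr // ler_piMl // ltW.
  have /andP[lo hi] := truncn_itv xN.
  by rewrite ler_pdivrMr // lo -[X in _ + X]mul1r -mulrDl ler_pdivlMr // natr1 ltW.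
- move=> _ p [k _ <-] pm.
  pose q : {ffun 'I_d -> 'I_m.+1} := [ffun i => inord (p i)].
  have qE : (fun i => q i : nat) = p.
    apply/funext => i; rewrite ffunE inordK // ltnS (leq_trans _ pm) //.
    by rewrite /order_mi (bigD1 i) //= leq_addr.
  have := gphi (k, q); have := hphi (k, q); rewrite /= qE => /(_ pm) leh /(_ pm).
  rewrite distrC => leg; rewrite exprVn.
  rewrite -(subrKA (c (phi (k, q)))) (le_trans (ler_normD _ _)) //.
  by apply: (le_trans (lerD leg leh)); rewrite -mulrDr; lra.
Qed.

Theorem theorem3 (R : realType) :
  exists Kc : R -> nat -> nat -> R -> R,
  forall (Y : completeNormedModType R) (d m : nat) (B : set Y) (KB tau : R),
    separable_hilbert_space Y ->
    (1 <= d)%N -> (1 <= m)%N ->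
    upper_box_dim B = tau%:E ->
    0 < KB -> (forall y, B y -> `|y| <= KB) ->
    exists delta0 : R, 0 < delta0 /\
      forall delta : R, 0 < delta < delta0 ->
        (metric_entropy (@sup_dist R Y d) delta (@Gclass R Y d m B)
           <= (Kc KB m d tau * delta `^ (- (d%:R / m%:R)) * ln (delta^-1))%:E)%E.
Proof.
pose A (KB : R) (m d : nat) : R := m.+1%:R ^+ d * (1 + 2 * KB).
(* The first two factors count grid points, via [N.+1 <= 2 * (a + 1) * q], and multi-indices; the
   last comes from [ln n <= (|tau| + 2) * ln r^-1] and [ln r^-1 <= 2 * ln delta^-1]. *)
exists (fun KB m d tau =>
  (2 * (A KB m d + 1)) ^+ d * m.+1%:R ^+ d * (2 * (`|tau| + 2))).
move=> Y d m B KB tau _ _ m1 dimB KB0 BK.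
have [eps eps0 cover] := upper_box_dim_cover _ _ _ _ dimB.
set a := A KB m d.
have a1 : 1 <= a.
  rewrite /a /A; apply: (@le_trans _ _ (1 + 2 * KB)); first lra.
  by rewrite ler_peMl ?exprn_ege1 ?ler1n //; lra.
(* Chosen so that [r^-1 = 2 * N ^ m <= C / delta], which is at most [delta^-2] once
   [delta < C^-1]. *)
pose C := 2 * (a + 1) ^+ m.
have C2 : 2 <= C by rewrite /C ler_peMr // exprn_ege1 //; lra.
exists (Num.min eps C^-1); split; first by rewrite lt_min eps0 invr_gt0; lra.
move=> delta /andP[delta0]; rewrite lt_min => /andP[delta_eps delta_C].
have C_delta : C <= delta^-1.
  by rewrite -[C]invrK lef_pV2 ?posrE ?invr_gt0 //; lra.
have m0 : (m%:R : R) != 0 by rewrite pnatr_eq0 -lt0n.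
pose q := delta `^ (- m%:R^-1).
have q_gt0 : 0 < q by rewrite powR_gt0.
have qm : q ^+ m = delta^-1.
  by rewrite -powR_mulrn ?ltW // -powRrM mulNr mulVf // powR_inv1 // ltW.
have qd : q ^+ d = delta `^ (- (d%:R / m%:R)).
  by rewrite -powR_mulrn ?ltW // -powRrM mulNr mulrC.
have q1 : 1 <= q.
  rewrite leNgt; apply/negP => qlt1.
  have : q ^+ m <= 1 by rewrite exprn_ile1 // ltW.
  by rewrite qm; lra.
(* [N > a * q] makes the mesh fine enough: [N ^ m >= (a * q) ^ m >= a / delta], by [a >= 1] and
   [m >= 1]. Since [q >= 1], rounding up still leaves [N <= (a + 1) * q]. *)
pose N := (Num.truncn (a * q)).+1.
have aq0 : 0 <= a * q by rewrite mulr_ge0 // ltW //; lra.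
have /andP[N_le aq_N] := truncn_itv aq0.
have N_up : N%:R <= (a + 1) * q by rewrite -natr1 mulrDl mul1r lerD.
have N_gt0 : (0 : R) < N%:R by rewrite ltr0n.
have Nm_gt0 : (0 : R) < N%:R ^+ m by rewrite exprn_gt0.
have le_delta : a * N%:R ^- m <= delta.
  rewrite ler_pdivrMr // -ler_pdivrMl // mulrC -qm.
  apply: (@le_trans _ _ ((a * q) ^+ m)); last first.
    by rewrite lerXn2r ?nnegrE // ltW.
  by rewrite exprMn ler_wpM2r ?exprn_ge0 ?(ltW q_gt0) // ler_eXnr.
pose r := N%:R ^- m / 2 : R.
have r_gt0 : 0 < r by rewrite divr_gt0 // invr_gt0.
have Nm1 : N%:R ^- m <= 1 :> R by rewrite invf_le1 // exprn_ege1 // ler1n.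
have r_delta : r < delta.
  have : N%:R ^- m <= a * N%:R ^- m by rewrite ler_peMl // invr_ge0 ltW.
  by rewrite /r in r_gt0 *; lra.
have [|n [c [n_le cB]]] := cover r _ ltac:(rewrite /r; lra).
  by rewrite r_gt0 (lt_trans r_delta).
have lnr : ln r^-1 <= 2 * ln delta^-1.
  rewrite -[2]/(1 + 1) mulrDl !mul1r -lnM ?posrE ?invr_gt0 //.
  rewrite ler_ln ?posrE ?mulr_gt0 ?invr_gt0 // invfM !invrK mulrC.
  apply: (@le_trans _ _ (C * delta^-1)); last by rewrite ler_wpM2r // invr_ge0 ltW.
  rewrite /C -mulrA ler_pM2l // -qm -exprMn lerXn2r ?nnegrE // ltW //.
  by rewrite mulr_gt0 //; lra.
have lnd : 0 <= ln delta^-1 by rewrite ln_ge0 //; lra.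
rewrite /metric_entropy; apply: elog_le; first exact: covering_number_ge0.
apply: (le_trans (covering_number_Gclass_le _ _ _ _ _ _ _ _ _ _ BK KB0 _ cB le_delta)) => //.
rewrite lee_fin natrX.
set T := `|tau| + 2 in n_le *.
have T0 : 0 <= T by rewrite /T addr_ge0.
apply: (@le_trans _ _ (expR (T * (2 * ln delta^-1)) ^+ (N.+1 ^ d * m.+1 ^ d))).
  rewrite lerXn2r ?nnegrE ?expR_ge0 //.
  by apply: (le_trans n_le); rewrite ler_expR ler_wpM2l.
rewrite -expRM_natl ler_expR -qd natrM !natrX.
have N1 : N.+1%:R ^+ d <= (2 * (a + 1)) ^+ d * q ^+ d.
  have N1 : N.+1%:R <= 2 * (a + 1) * q.
    have : (1 : R) <= N%:R by rewrite ler1n.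
    by rewrite -[N.+1]addn1 natrD; lra.
  by rewrite -exprMn lerXn2r ?nnegrE // (le_trans _ N1).
have W : 0 <= m.+1%:R ^+ d * (T * (2 * ln delta^-1)) by rewrite !mulr_ge0 ?exprn_ge0.
rewrite -mulrA; apply: (le_trans (ler_wpM2r W N1)).
by rewrite le_eqVlt; apply/orP; left; apply/eqP; ring.
Qed.
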